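(* Let $\mathcal S$ be a $\mathbf q$-substitution on $\mathcal A$ such that $\mathcal S$ and $\mathcal S\otimes\mathcal S$ have index of imprimitivity $1$, and let $\mathcal E_1,\dots,\mathcal E_J$ and $\mathcal T$ be the ergodic classes and transient part of $\mathcal S\otimes\mathcal S$. Let $\mu\in\mathcal M(X_{\mathcal S},T)$ and $u_\alpha=\mu([\alpha])$. Then $\mathbf v\in\mathbb C^{\mathcal A^2}$ lies in the spectral hull $\mathcal K(\mathcal S)$ if and only if $\mathring{\mathbf v}$ is self-adjoint with nonnegative eigenvalues, $\sum_{\alpha\in\mathcal A}v_{\alpha\alpha}u_\alpha=1$, and for some $w_1,\dots,w_J\in\mathbb C$, with $\mathcal V_{\mathcal E}=\sum_{j=1}^J\sum_{\alpha\beta\in\mathcal E_j}w_j\,\mathbf e_{\alpha\beta}$, $$\mathbf v=\mathcal V_{\mathcal E}-(Q\mathbf I-C_{\mathcal T}^t)^{-1}(Q\mathbf I-C_{\mathcal S}^t)\mathcal V_{\mathcal E}.$$ In particular, for $\mathbf v\in\mathcal K(\mathcal S)$: if $\mathcal T=\emptyset$ then $\mathbf v=\mathcal V_{\mathcal E}$; and if $\mathcal S$ is primitive then $v_{\alpha\alpha}=1$ for all $\alpha\in\mathcal A$.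
   Context: Conventions: fix $d\ge1$; operations and inequalities on $\mathbb Z^d$ are coordinatewise, $[\mathbf a,\mathbf b)=\{\mathbf j:a_i\le j_i<b_i\}$. Fix $\mathbf q\in\mathbb Z^d$ with all $q_i\ge2$, $Q=q_1\cdots q_d$. For $\mathbf k\in\mathbb Z^d$, $\lceil\mathbf k\rceil_1\in[\mathbf 0,\mathbf q)$ and $\lfloor\mathbf k\rfloor_1\in\mathbb Z^d$ are the unique elements with $\mathbf k=\lceil\mathbf k\rceil_1+\lfloor\mathbf k\rfloor_1\mathbf q$. Substitutions: $\mathcal A$ is a finite alphabet with at least two letters; the shift on $\mathcal A^{\mathbb Z^d}$ is $(T^{\mathbf k}A)(\mathbf j)=A(\mathbf j+\mathbf k)$. A block is a map from a finite subset of $\mathbb Z^d$ to $\mathcal A$. A $\mathbf q$-substitution $\mathcal S$ assigns to each letter $\gamma$ a block $\mathcal S(\gamma):[\mathbf 0,\mathbf q)\to\mathcal A$; it extends to blocks and sequences by $(\mathcal S\omega)(\mathbf j)=\mathcal S(\omega(\lfloor\mathbf j\rfloor_1))(\lceil\mathbf j\rceil_1)$. $X_{\mathcal S}$ is the set of sequences all of whose finite sub-blocks occur, up to translation, as sub-blocks of some $\mathcal S^n(\gamma)$. $[\alpha]=\{A\in X_{\mathcal S}:A(\mathbf 0)=\alpha\}$; $\mathcal M(X_{\mathcal S},T)$ is the set of $T$-invariant Borel probability measures on $X_{\mathcal S}$. $\mathcal S$ is primitive if for some $n>0$ every letter appears in every $\mathcal S^n(\gamma)$. Ergodic decomposition: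 for a $\mathbf q$-substitution $\mathcal S$ on an alphabet $\mathcal B$ there are $h>0$ and a partition $\mathcal B=\mathcal E_1\sqcup\cdots\sqcup\mathcal E_J\sqcup\mathcal T$ such that $\mathcal S^h$ restricts to a primitive substitution on each $\mathcal E_i$ and, for $\gamma\in\mathcal T$, $\mathcal S^h(\gamma)$ contains a letter not in $\mathcal T$. The least such $h$ is the index of imprimitivity, the $\mathcal E_i$ are the ergodic classes, $\mathcal T$ the transient part. Matrices: $\mathcal R_{\mathbf j}(\gamma)=\mathcal S(\gamma)(\mathbf j)$, also viewed as the $\mathcal A\times\mathcal A$ matrix with $(\alpha,\gamma)$ entry $1$ if $\alpha=\mathcal R_{\mathbf j}(\gamma)$ and $0$ otherwise. The bisubstitution $\mathcal S\otimes\mathcal S$ is the $\mathbf q$-substitution on $\mathcal A^2$ with instructions $\alpha\beta\mapsto\mathcal R_{\mathbf j}(\alpha)\mathcal R_{\mathbf j}(\beta)$; $C_{\mathcal S}=\sum_{\mathbf j\in[\mathbf 0,\mathbf q)}\mathcal R_{\mathbf j}\otimes\mathcal R_{\mathbf j}$ (Kronecker product). $\mathcal P_{\mathcal T}$ is the orthogonal projection of $\mathbb C^{\mathcal A^2}$ onto the span of $\{\mathbf e_{\alpha\beta}:\alpha\beta\in\mathcal T\}$ and $C_{\mathcal T}^t:=C_{\mathcal S}^t\mathcal P_{\mathcal T}$. Spectral hull: $\mathring{\mathbf v}=(v_{\alpha\beta})_{\alpha,\beta\in\mathcal A}$ is the $\mathcal A\times\mathcal A$ matrix associated to $\mathbf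 v\in\mathbb C^{\mathcal A^2}$; $\mathbf v$ is strongly semipositive if $\mathring{\mathbf v}$ is positive semidefinite. With $\widehat\Sigma(\mathbf 0)=\sum_\alpha\mu([\alpha])\mathbf e_{\alpha\alpha}$, $\mathcal K(\mathcal S)=\{\mathbf v\in\mathbb C^{\mathcal A^2}:C_{\mathcal S}^t\mathbf v=Q\mathbf v,\ \mathbf v\text{ strongly semipositive},\ \mathbf v^t\widehat\Sigma(\mathbf 0)=1\}$. *)

(* Defs.v *)
From HB Require Import structures.
From mathcomp Require Import all_boot all_order all_algebra.
From mathcomp Require Import all_classical all_reals all_analysis.
From mathcomp Require Import complex mxtens.

Set Implicit Arguments.
Unset Strict Implicit.
Unset Printing Implicit Defensive.

Import Order.TTheory GRing.Theory Num.Theory.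
Local Open Scope classical_set_scope.
Local Open Scope sesquilinear_scope.
Local Open Scope ring_scope.

Definition Zd (d : nat) := {ffun 'I_d -> int}.

Record base (d : nat) := Base {
  radix :> 'I_d -> nat;
  radix_ge2 : forall i, (2 <= radix i)%N }.

(* The box [0, q). *)
Definition digit d (q : base d) := {dffun forall i : 'I_d, 'I_(q i)}.

Definition volume d (q : base d) : nat := (\prod_(i < d) q i)%N.

Section Digits.
Variables (d : nat) (q : base d).

Lemma ceil1_subproof (k : Zd d) (i : 'I_d) :
  (`|(k i %% (q i)%:Z)%Z|%N < q i)%N.
Proof.
have q0 : (q i)%:Z != 0 by rewrite eqz_nat -lt0n (leq_trans _ (radix_ge2 q i)).
by rewrite -ltz_nat gez0_abs ?modz_ge0 // ltz_mod.
Qed.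

Definition ceil1 (k : Zd d) : digit q :=
  [ffun i => Ordinal (ceil1_subproof k i)].

Definition floor1 (k : Zd d) : Zd d := [ffun i => (k i %/ (q i)%:Z)%Z].

Lemma ceil1_floor1 (k : Zd d) (i : 'I_d) :
  k i = (ceil1 k i : nat)%:Z + floor1 k i * (q i)%:Z.
Proof.
have q0 : (q i)%:Z != 0 by rewrite eqz_nat -lt0n (leq_trans _ (radix_ge2 q i)).
by rewrite !ffunE /= gez0_abs ?modz_ge0 // addrC -divz_eq.
Qed.

End Digits.

Definition substitution d (q : base d) (A : Type) := A -> digit q -> A.

(* A block is a partial map from Z^d to the alphabet ([None] outside its
   domain).  The only blocks used below are the iterates S^n(gamma), whose
   domains are finite. *)
Definition block d (A : Type) := Zd d -> option A.

Section Substitutions.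
Variables (d : nat) (q : base d) (A : Type).
Implicit Type S : substitution q A.

Definition letter_block (a : A) : block d A :=
  fun j => if j == 0 then Some a else None.

Definition subst_block S (w : block d A) : block d A :=
  fun j => omap (fun a => S a (ceil1 q j)) (w (floor1 q j)).

Definition subst_iter S (n : nat) (w : block d A) : block d A :=
  iter n (subst_block S) w.

Definition occurs (a : A) (w : block d A) : Prop := exists j, w j = Some a.

Definition primitive S : Prop :=
  exists2 n, (0 < n)%N & forall a g, occurs a (subst_iter S n (letter_block g)).

(* X_S *)
Definition subst_space S : set (Zd d -> A) :=
  [set x | forall F : set (Zd d), finite_set F ->
     exists (n : nat) (g : A) (k : Zd d), forall j, F j ->
       subst_iter S n (letter_block g) (j + k) = Some (x j)].

Definition shift (k : Zd d) (x : Zd d -> A) : Zd d -> A := fun j => x (j + k).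

Definition cylinder S (a : A) : set (Zd d -> A) :=
  subst_space S `&` [set x | x 0 = a].

End Substitutions.

Section ErgodicDecomposition.
Variables (d : nat) (q : base d) (B : finType).
Implicit Type S : substitution q B.

(* S^h restricts to a primitive substitution on the letters of E. *)
Definition primitive_on S (h : nat) (E : {set B}) : Prop :=
  (forall g a, g \in E -> occurs a (subst_iter S h (letter_block g)) ->
     a \in E) /\
  exists2 n, (0 < n)%N & forall a g, a \in E -> g \in E ->
     occurs a (iter n (subst_iter S h) (letter_block g)).

Definition ergodic_decomposition S (h J : nat) (E : 'I_J -> {set B})
    (T : {set B}) : Prop :=
  [/\ injective E,
      finset.partition [set E i | i : 'I_J] (~: T),
      forall i, primitive_on S h (E i) &
      forall g, g \in T -> exists2 a, a \notin T &
        occurs a (subst_iter S h (letter_block g))].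

Definition has_ergodic_decomposition S (h : nat) : Prop :=
  exists (J : nat) (E : 'I_J -> {set B}) (T : {set B}),
    ergodic_decomposition S h E T.

Definition imprimitivity_index S (h : nat) : Prop :=
  [/\ (0 < h)%N, has_ergodic_decomposition S h &
      forall h', (0 < h')%N -> has_ergodic_decomposition S h' -> (h <= h')%N].

Definition ergodic_classes S (J : nat) (E : 'I_J -> {set B}) (T : {set B})
    : Prop :=
  exists2 h, imprimitivity_index S h & ergodic_decomposition S h E T.

End ErgodicDecomposition.

Definition bisubst d (q : base d) (A : Type) (S : substitution q A)
    : substitution q (A * A) :=
  fun ab j => (S ab.1 j, S ab.2 j).

(* A^(Z^d) with the product of the discrete topologies.  Measurable types are
   pointed in the library; [hA] only serves to provide a point. *)
Definition config (A : finType) (hA : (2 <= #|A|)%N) (d : nat) : Type :=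
  prod_topology (fun _ : Zd d => discrete_topology A).

Section Config.
Variables (A : finType) (hA : (2 <= #|A|)%N) (d : nat).

HB.instance Definition _ := Topological.copy (config hA d)
  (prod_topology (fun _ : Zd d => discrete_topology A)).
HB.instance Definition _ := isPointed.Build (config hA d)
  (fun=> enum_val (Ordinal (ltnW hA))).

Definition borel_config := g_sigma_algebraType (@open (config hA d)).

Lemma closed_subst_space (q : base d) (S : substitution q A) :
  closed (subst_space S : set (config hA d)).
Proof.
have -> : subst_space S = \bigcap_(F in [set F : set (Zd d) | finite_set F])
    [set x : config hA d | exists (n : nat) (g : A) (k : Zd d), forall j, F j ->
       subst_iter S n (letter_block g) (j + k) = Some (x j)] by [].
apply: closed_bigI => F finF; rewrite -openC openE => x /= Px.
have : nbhs x (\bigcap_(j in F) [set y : config hA d | y j = x j]).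
  have /finite_fsetP[X FX] := finF; rewrite FX.
  apply: filter_bigI => j _.
  apply: (@proj_continuous (Zd d) (fun=> discrete_topology A) j x [set x j]).
  exact: discrete_set1.
apply: filterS => y yx [n [g [k H]]]; apply: Px; exists n, g, k => j Fj.
by rewrite H // (yx j Fj).
Qed.

Lemma measurable_subst_space (q : base d) (S : substitution q A) :
  measurable (subst_space S : set borel_config).
Proof.
rewrite -[X in measurable X]setCK; apply: measurableC.
by apply: sub_sigma_algebra; rewrite openC; exact: closed_subst_space.
Qed.

End Config.

(* M(X_S, T): as X_S is a Borel subset of A^(Z^d), a Borel probability measure
   on X_S is one on A^(Z^d) giving X_S full mass. *)
Definition invariant_measure (R : realType) d (q : base d) (A : finType)
    (hA : (2 <= #|A|)%N) (S : substitution q A)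
    (mu : probability (borel_config hA d) R) : Prop :=
  mu (subst_space S) = 1%E /\
  forall (k : Zd d) (B : set (borel_config hA d)),
    measurable B -> mu (shift k @^-1` B) = mu B.

(* C^(A^2) is represented by columns of height #|A| * #|A|, the coordinate
   (a, b) having the index used by the Kronecker product *t. *)
Section Matrices.
Variables (R : realType) (d : nat) (q : base d) (A : finType).
Local Notation C := R[i].
Local Notation vec := 'cV[C]_(#|A| * #|A|).
Local Notation mat := 'M[C]_(#|A| * #|A|).
Implicit Types (S : substitution q A) (v : vec) (T : {set A * A}).

Definition pair_index (a b : A) : 'I_(#|A| * #|A|) :=
  mxtens_index (enum_rank a, enum_rank b).

Definition basis_vec (a b : A) : vec := delta_mx (pair_index a b) 0.

Definition entry v (a b : A) : C := v (pair_index a b) 0.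

Definition assoc_mx v : 'M[C]_#|A| :=
  \matrix_(i, j) entry v (enum_val i) (enum_val j).

Definition instr_mx S (j : digit q) : 'M[C]_#|A| :=
  \matrix_(a, g) (enum_val a == S (enum_val g) j)%:R.

Definition coincidence_mx S : mat :=
  \sum_(j : digit q) tensmx (instr_mx S j) (instr_mx S j).

Definition proj_transient T : mat :=
  \sum_(ab in T) delta_mx (pair_index ab.1 ab.2) (pair_index ab.1 ab.2).

(* C_T^t *)
Definition coincidence_tr_transient S T : mat :=
  (coincidence_mx S)^T *m proj_transient T.

Definition psdmx n (M : 'M[C]_n) : Prop :=
  forall x : 'cV[C]_n, 0 <= (x ^t* *m M *m x) 0 0.

Definition strongly_semipositive v : Prop := psdmx (assoc_mx v).

Definition class_vec (J : nat) (E : 'I_J -> {set A * A}) (w : 'I_J -> C) : vec :=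
  \sum_(j < J) \sum_(ab in E j) w j *: basis_vec ab.1 ab.2.

Variable hA : (2 <= #|A|)%N.
Variable mu : probability (borel_config hA d) R.

Definition letter_freq S (a : A) : C := (fine (mu (cylinder S a)))%:C%C.

(* \hat\Sigma(0) *)
Definition Sigma0 S : vec := \sum_(a : A) letter_freq S a *: basis_vec a a.

Definition spectral_hull S : set vec :=
  [set v | [/\ (coincidence_mx S)^T *m v = (volume q)%:R *: v,
               strongly_semipositive v &
               (v^T *m Sigma0 S) 0 0 = 1]].

End Matrices.

(* Main.v *)
(* Dividing C_S^t by Q gives the transition operator of the Markov chain on
   pairs that moves alpha beta to the pair read at a uniformly chosen digit, so
   C_S^t v = Q v says that v is harmonic.  By the maximum principle, applied to
   the real and imaginary parts, a harmonic v is constant on each ergodic class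
   and is determined by these constants, since every transient pair leaves T in
   one step with positive probability.  The displayed formula solves the
   Dirichlet problem on T with the values w_j on the classes. *)
Require Import Defs.
From HB Require Import structures.
From mathcomp Require Import all_boot all_order all_algebra.
From mathcomp Require Import all_classical all_reals all_analysis.
From mathcomp Require Import complex mxtens.

Set Implicit Arguments.
Unset Strict Implicit.
Unset Printing Implicit Defensive.

Import Order.TTheory GRing.Theory Num.Theory.
Local Open Scope classical_set_scope.
Local Open Scope sesquilinear_scope.
Local Open Scope ring_scope.

(** * Counting the digits *)

Lemma card_digit d (q : base d) : #|{: digit q}| = volume q.
Proof.
rewrite card_dep_ffun foldrE big_map big_enum.
by apply: eq_bigr => i _; rewrite card_ord.
Qed.

Lemma volume_gt0 d (q : base d) : (0 < volume q)%N.
Proof. by apply: prodn_gt0 => i; apply: leq_trans (radix_ge2 q i). Qed.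

(** * Letters occurring in iterated blocks *)

Section Occurrence.
Variables (d : nat) (q : base d) (B : Type) (S : substitution q B).

Lemma occurs_closed (P : B -> Prop) (w : block d B) :
  (forall b j, P b -> P (S b j)) -> (forall a, occurs a w -> P a) ->
  forall a, occurs a (subst_block S w) -> P a.
Proof.
move=> PS Pw a [j]; rewrite /subst_block.
by case wj: (w _) => [b|//] /= [<-]; apply/PS/Pw; exists (Defs.floor1 q j).
Qed.

(** This is how primitivity enters: stability under the instructions propagates along the iterates,
    so a stable set meeting a class contains the class. *)
Lemma occurs_iter_closed (P : B -> Prop) n g :
  (forall b j, P b -> P (S b j)) -> P g ->
  forall a, occurs a (subst_iter S n (letter_block g)) -> P a.
Proof.
move=> PS Pg; elim: n => [|n IHn]; last exact: occurs_closed.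
by move=> a [j]; rewrite /= /letter_block; case: ifP => // _ [<-].
Qed.

Lemma occurs_subst a g :
  occurs a (subst_block S (letter_block g)) <-> exists j, a = S g j.
Proof.
split=> [[k]|[j ->]].
  rewrite /subst_block /letter_block; case: ifP => //= _ [<-].
  by exists (Defs.ceil1 q k).
(* The digit read as a point of Z^d: its floor is 0, the only cell of [letter_block g]. *)
pose k : Zd d := [ffun i => (j i : nat)%:Z]; exists k.
have fk : Defs.floor1 q k = 0.
  apply/ffunP => i; rewrite !ffunE divz_nat divn_small //.
have ck : Defs.ceil1 q k = j.
  apply/ffunP => i; rewrite ffunE; apply: val_inj => /=.
  by rewrite ffunE modz_nat modn_small.
by rewrite /subst_block /letter_block fk eqxx /= ck.
Qed.

End Occurrence.

Definition step_harmonic (K : pzRingType) (B I : finType) (step : B -> I -> B)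
    (f : B -> K) (x : B) : Prop :=
  #|I|%:R * f x = \sum_i f (step x i).

(** * Maximum principle for real-valued harmonic functions *)

Section MaximumPrinciple.
Variables (K : realDomainType) (B I : finType) (step : B -> I -> B).
Implicit Types (f : B -> K) (P : {set B}).

(** The differences [f x - f (step x k)] are nonnegative and harmonicity makes them sum to zero, so
    each vanishes. *)
Lemma max_step f P x i :
  (forall y, y \in P -> step_harmonic step f y) ->
  (forall y k, y \in P -> step y k \in P) ->
  x \in P -> (forall y, y \in P -> f y <= f x) -> f (step x i) = f x.
Proof.
move=> fP PS xP fx; apply/eqP; rewrite eq_sym -subr_eq0.
have : \sum_k (f x - f (step x k)) == 0.
  by rewrite sumrB sumr_const -mulr_natl fP // subrr.
rewrite psumr_eq0 => [/allP/(_ i)|k _]; last by rewrite subr_ge0 fx // PS.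
by rewrite mem_index_enum => /(_ isT).
Qed.

(** By [max_step] the maximisers of [f] in [P] form a stable set, which irreducibility spreads over
    all of [P]. *)
Lemma harmonic_const f P :
  (forall y, y \in P -> step_harmonic step f y) ->
  (forall y k, y \in P -> step y k \in P) ->
  (forall P' : {set B}, (forall y k, y \in P' -> step y k \in P') ->
     forall x y, x \in P -> x \in P' -> y \in P -> y \in P') ->
  {in P &, forall x y, f x = f y}.
Proof.
move=> fP PS Pirr x y xP yP.
have [m mP fm] := arg_maxP f xP.
suff fPm z : z \in P -> f z = f m by rewrite !fPm.
move=> zP; suff : z \in [set t in P | f t == f m]%SET.
  by rewrite inE => /andP[_ /eqP].
apply: (Pirr _ _ m) => //; last by rewrite inE eqxx andbT.
move=> t k; rewrite !inE => /andP[tP /eqP ft]; rewrite PS //= -ft.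
by apply/eqP/(max_step k fP PS) => // u uP; rewrite ft; exact: fm.
Qed.

(** A global maximum attained in [Tr] is shared by an exit point, where [f] vanishes. *)
Lemma harmonic_le0 f (Tr : {set B}) :
  (forall y, step_harmonic step f y) -> (forall y, y \notin Tr -> f y = 0) ->
  (forall y, y \in Tr -> exists k, step y k \notin Tr) ->
  forall x, f x <= 0.
Proof.
move=> fH f0 Tout x.
have [m _ fm] := arg_maxP (P := xpredT) f (isT : xpredT x).
apply: le_trans (fm x isT) _; case: (boolP (m \in Tr)) => [mT|/f0->//].
have [k kT] := Tout m mT.
have <- : f (step m k) = f m; last by rewrite f0.
by apply: (@max_step f [set: B]%SET) => // y; rewrite ?inE // => _; exact: fm.
Qed.

Lemma harmonic_eq0 f (Tr : {set B}) :
  (forall y, step_harmonic step f y) -> (forall y, y \notin Tr -> f y = 0) ->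
  (forall y, y \in Tr -> exists k, step y k \notin Tr) ->
  forall x, f x = 0.
Proof.
move=> fH f0 Tout x; apply/eqP; rewrite eq_le (harmonic_le0 fH f0 Tout) /=.
rewrite -oppr_le0; apply: (@harmonic_le0 (\- f) Tr) => // y.
- by rewrite /step_harmonic /= mulrN fH sumrN.
- by move=> yT /=; rewrite f0 ?oppr0.
Qed.

End MaximumPrinciple.

(** * Complex values, through real and imaginary parts *)

Section ComplexMaximumPrinciple.
Variables (R : rcfType) (B I : finType) (step : B -> I -> B).
Implicit Types (f : B -> R[i]) (P : {set B}).
Local Notation Re := (@complex.Re R).
Local Notation Im := (@complex.Im R).

Lemma harmonic_Re f x :
  step_harmonic step f x -> step_harmonic step (fun y => Re (f y)) x.
Proof.
have ReD : {morph Re : x y / x + y >-> x + y} by case=> ? ? [].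
(* The factor [#|I|] becomes a constant sum, so additivity of [Re] is enough. *)
rewrite /step_harmonic !mulr_natl -!sumr_const => /(congr1 Re).
by rewrite !(big_morph Re ReD (erefl : Re 0 = 0)).
Qed.

Lemma harmonic_Im f x :
  step_harmonic step f x -> step_harmonic step (fun y => Im (f y)) x.
Proof.
have ImD : {morph Im : x y / x + y >-> x + y} by case=> ? ? [].
rewrite /step_harmonic !mulr_natl -!sumr_const => /(congr1 Im).
by rewrite !(big_morph Im ImD (erefl : Im 0 = 0)).
Qed.

Lemma complex_harmonic_const f P :
  (forall y, y \in P -> step_harmonic step f y) ->
  (forall y k, y \in P -> step y k \in P) ->
  (forall P' : {set B}, (forall y k, y \in P' -> step y k \in P') ->
     forall x y, x \in P -> x \in P' -> y \in P -> y \in P') ->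
  {in P &, forall x y, f x = f y}.
Proof.
move=> fP PS Pirr x y xP yP; apply/eqP; rewrite eq_complex.
apply/andP; split; apply/eqP.
- by apply: (@harmonic_const _ _ _ step (Re \o f) P) => // z /fP/harmonic_Re.
- by apply: (@harmonic_const _ _ _ step (Im \o f) P) => // z /fP/harmonic_Im.
Qed.

Lemma complex_harmonic_eq0 f (Tr : {set B}) :
  (forall y, step_harmonic step f y) -> (forall y, y \notin Tr -> f y = 0) ->
  (forall y, y \in Tr -> exists k, step y k \notin Tr) ->
  forall x, f x = 0.
Proof.
move=> fH f0 Tout x; apply/eqP; rewrite eq_complex.
apply/andP; split; apply/eqP.
- apply: (@harmonic_eq0 _ _ _ step (Re \o f) Tr) => // y => [|/= /f0->//].
  exact: harmonic_Re.
- apply: (@harmonic_eq0 _ _ _ step (Im \o f) Tr) => // y => [|/= /f0->//].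
  exact: harmonic_Im.
Qed.

End ComplexMaximumPrinciple.

(** * Positive semidefinite forms and nonnegative spectrum *)

Section Psd.
Variables (C : numClosedFieldType) (n : nat).
Implicit Type M : 'M[C]_n.

Lemma trmxC_mul m p k (A : 'M[C]_(m, p)) (B : 'M[C]_(p, k)) :
  (A *m B)^t* = B^t* *m A^t*.
Proof. by rewrite trmx_mul map_mxM. Qed.

Lemma form_delta M i j :
  ((delta_mx i 0 : 'cV_n)^t* *m M *m (delta_mx j 0 : 'cV_n)) 0 0 = M i j.
Proof.
by rewrite trmx_delta map_delta_mx -rowE -colE !mxE.
Qed.

Lemma form_add M (x y : 'cV[C]_n) :
  (x + y)^t* *m M *m (x + y)
  = x^t* *m M *m x + y^t* *m M *m y + (x^t* *m M *m y + y^t* *m M *m x).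
Proof.
have -> : (x + y)^t* = x^t* + y^t* by rewrite linearD map_mxD.
rewrite !mulmxDl !mulmxDr.
by rewrite -!addrA; congr (_ + _); rewrite [RHS]addrC addrA.
Qed.

(** Polarization: the basis vectors e_i and e_j give [M i j + M j i = 0], while e_i and ['i] times
    e_j give [M i j = M j i]. *)
Lemma form_eq0 M :
  (forall x : 'cV[C]_n, (x^t* *m M *m x) 0 0 = 0) -> M = 0.
Proof.
move=> M0; have cross (x y : 'cV[C]_n) :
    (x^t* *m M *m y) 0 0 + (y^t* *m M *m x) 0 0 = 0.
  have D00 (X Y : 'M[C]_1) : (X + Y) 0 0 = X 0 0 + Y 0 0 by rewrite mxE.
  by have := M0 (x + y); rewrite form_add !D00 !M0 !add0r.
apply/matrixP => i j; rewrite [RHS]mxE.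
have := cross (delta_mx i 0) (delta_mx j 0); rewrite !form_delta => e1.
have := cross (delta_mx i 0) ('i *: delta_mx j 0).
have -> : ('i *: delta_mx j 0 : 'cV[C]_n)^t* = - 'i *: (delta_mx j 0)^t*.
  by apply/matrixP => k l; rewrite !mxE rmorphM /= conjCi.
have Z00 a (X : 'M[C]_1) : (a *: X) 0 0 = a * X 0 0 by rewrite mxE.
rewrite -!scalemxAl -scalemxAr !Z00 !form_delta mulNr -mulrBr.
move/eqP; rewrite mulf_eq0 (negPf (neq0Ci _)) /= subr_eq0 => /eqP e2.
by move: e1 => /eqP; rewrite -e2 -mulr2n mulrn_eq0 /= => /eqP.
Qed.

(** The form of [M] minus its adjoint is the form of [M] minus its conjugate, which is zero since
    nonnegative values are real. *)
Lemma form_ge0_hermsym M :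
  (forall x : 'cV[C]_n, 0 <= (x^t* *m M *m x) 0 0) -> M \is hermsymmx.
Proof.
move=> M0; apply/is_hermitianmxP; rewrite expr0 scale1r.
apply/eqP; rewrite -subr_eq0; apply/eqP/form_eq0 => x.
rewrite mulmxBr mulmxBl mxE [X in _ + X]mxE.
apply/eqP; rewrite subr_eq0 eq_sym; apply/eqP.
have -> : x^t* *m M^t* *m x = (x^t* *m M *m x)^t*.
  by rewrite !trmxC_mul trmxCK mulmxA.
have tC00 (X : 'M[C]_1) : X^t* 0 0 = (X 0 0)^* by rewrite !mxE.
by rewrite tC00; apply/CrealP/ger0_real/M0.
Qed.

Lemma dot_gt0 (v : 'rV[C]_n) : v != 0 -> 0 < (v *m v^t*) 0 0.
Proof.
move=> v0; rewrite !mxE lt_neqAle; apply/andP; split; last first.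
  by apply: sumr_ge0 => i _; rewrite !mxE mul_conjC_ge0.
apply: contraNneq v0 => /esym/eqP; rewrite psumr_eq0 => [/allP s0|i _]; last first.
  by rewrite !mxE mul_conjC_ge0.
apply/eqP/rowP => i; apply/eqP; rewrite mxE -mul_conjC_eq0.
by have := s0 i (mem_index_enum _); rewrite !mxE.
Qed.

Lemma form_ge0P M :
  (forall x : 'cV[C]_n, 0 <= (x^t* *m M *m x) 0 0) <->
  (M \is hermsymmx /\ forall c, eigenvalue M c -> 0 <= c).
Proof.
split=> [M0|[Mh Me] x].
  split=> [|c /eigenvalueP[v vM v0]]; first exact: form_ge0_hermsym.
  (* [eigenvalue] refers to row vectors, so the form is tested at the conjugate transpose of [v],
     giving [c] times a squared norm. *)
  have := M0 (v^t*); rewrite trmxCK vM -scalemxAl mxE.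
  by rewrite pmulr_lge0 // dot_gt0.
have /hermitian_normalmx/orthomx_spectralP := Mh.
set P := spectralmx M; set D := spectral_diag M => MP.
have Pu : P \in unitmx by exact: spectral_unit.
have PM : P *m M = diag_mx D *m P by rewrite MP !mulmxA mulmxV // mul1mx.
(* The rows of [P] are left eigenvectors, nonzero because [P] is invertible. *)
have D0 i : 0 <= D 0 i.
  apply: Me; apply/eigenvalueP; exists (row i P).
    by rewrite -row_mul PM mul_diag_mx; apply/rowP => j; rewrite !mxE.
  apply: contraTneq Pu => Pi; rewrite -row_free_unit.
  apply/negP => /(row_free_inj (m := 1)) /(_ (delta_mx 0 i) 0).
  rewrite -rowE Pi mul0mx => /(_ erefl)/matrixP/(_ 0 i).
  by rewrite !mxE !eqxx => /eqP; rewrite oner_eq0.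
(* Unitarity of [P] turns the form into a sum of [D 0 i] times squared moduli of the coordinates of
   [P *m x]. *)
have -> : x^t* *m M *m x = (P *m x)^t* *m (diag_mx D *m (P *m x)).
  rewrite trmxC_mul [M in LHS]MP invmx_unitary ?spectral_unitarymx //.
  by rewrite !mulmxA.
rewrite mxE; apply: sumr_ge0 => i _; rewrite mul_diag_mx !mxE.
rewrite mulrCA mulr_ge0 // mulrC mul_conjC_ge0 //.
Qed.

End Psd.

(** * Coordinates indexed by pairs of letters *)

Section PairCoordinates.
Variables (R : realType) (d : nat) (q : base d) (A : finType).
Local Notation C := R[i].
Local Notation vec := 'cV[C]_(#|A| * #|A|).
Implicit Types (S : substitution q A) (v : vec) (T : {set A * A}).

Lemma pair_index_bij :
  bijective (fun ab : A * A => pair_index ab.1 ab.2).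
Proof.
exists (fun k => (enum_val (mxtens_unindex k).1, enum_val (mxtens_unindex k).2)).
  by move=> [a b]; rewrite /pair_index mxtens_indexK /= !enum_rankK.
by move=> k; rewrite /pair_index !enum_valK -surjective_pairing mxtens_unindexK.
Qed.

Lemma pair_index_eq (x y : A * A) :
  (pair_index x.1 x.2 == pair_index y.1 y.2) = (x == y).
Proof. exact/(inj_eq (bij_inj pair_index_bij)). Qed.

Lemma entry_inj v w : (forall x, entry v x.1 x.2 = entry w x.1 x.2) -> v = w.
Proof.
move=> vw; apply/colP => k; have [g _ gK] := pair_index_bij.
by rewrite -[k]gK; exact: vw.
Qed.

Lemma entry_mul (M : 'M[C]_(#|A| * #|A|)) v a b :
  entry (M *m v) a b =
  \sum_(x : A * A) M (pair_index a b) (pair_index x.1 x.2) * entry v x.1 x.2.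
Proof.
by rewrite /entry mxE (reindex _ (onW_bij _ pair_index_bij)).
Qed.

Lemma entryB v w a b : entry (v - w) a b = entry v a b - entry w a b.
Proof. by rewrite /entry !mxE. Qed.

Lemma entryZ (c : C) v a b : entry (c *: v) a b = c * entry v a b.
Proof. by rewrite /entry !mxE. Qed.

Lemma entry_sum (I : finType) (P : pred I) (F : I -> vec) a b :
  entry (\sum_(i | P i) F i) a b = \sum_(i | P i) entry (F i) a b.
Proof. by rewrite /entry summxE. Qed.

Lemma entry_basis (x y : A * A) :
  entry (basis_vec R y.1 y.2) x.1 x.2 = (x == y)%:R.
Proof. by rewrite /entry /basis_vec mxE pair_index_eq eqxx andbT. Qed.

(** For each digit [j], the column of the Kronecker square at [x] has its single 1 in the row of
    [bisubst S x j]; transposing turns it into evaluation there. *)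
Lemma entry_coincidence_tr S v x :
  entry ((coincidence_mx R S)^T *m v) x.1 x.2 =
  \sum_j entry v (bisubst S x j).1 (bisubst S x j).2.
Proof.
rewrite entry_mul.
transitivity (\sum_(y : A * A) \sum_j
    (y == bisubst S x j)%:R * entry v y.1 y.2).
  apply: eq_bigr => y _; rewrite -mulr_suml; congr (_ * _).
  rewrite mxE summxE; apply: eq_bigr => j _.
  by rewrite tensmxE !mxE !enum_rankK -natrM mulnb.
rewrite exchange_big; apply: eq_bigr => j _ /=.
rewrite (bigD1 (bisubst S x j)) //= eqxx mul1r big1 ?addr0 // => y /negPf->.
by rewrite mul0r.
Qed.

Lemma entry_proj_transient T v x :
  entry (proj_transient R T *m v) x.1 x.2 = (x \in T)%:R * entry v x.1 x.2.
Proof.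
rewrite entry_mul (bigD1 x) //= big1 ?addr0 => [|y yx].
  congr (_ * _); rewrite summxE; have [xT|xT] := boolP (x \in T).
    rewrite (bigD1 x) //= mxE !eqxx big1 ?addr0 // => y /andP[_ yx].
    by rewrite mxE !pair_index_eq eq_sym (negPf yx).
  rewrite big1 // => y yT; rewrite mxE !pair_index_eq.
  by case: eqP => // xy; rewrite xy yT in xT.
rewrite summxE big1 ?mul0r // => z _; rewrite mxE !pair_index_eq.
by case: (x =P z) => // <-; rewrite (negPf yx).
Qed.

Lemma entry_class_vec J (E : 'I_J -> {set A * A}) (w : 'I_J -> C) x j :
  (forall i, x \in E i -> i = j) -> x \in E j ->
  entry (class_vec E w) x.1 x.2 = w j.
Proof.
move=> Euniq xE; rewrite /class_vec entry_sum.
have ent i : entry (\sum_(y in E i) w i *: basis_vec R y.1 y.2) x.1 x.2 =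
    (x \in E i)%:R * w i.
  rewrite entry_sum; have [xi|xi] := boolP (x \in E i).
    rewrite (bigD1 x) //= entryZ entry_basis eqxx mulr1 mul1r big1 ?addr0 //.
    by move=> y /andP[_ yx]; rewrite entryZ entry_basis eq_sym (negPf yx) mulr0.
  rewrite mul0r big1 // => y yi; rewrite entryZ entry_basis.
  by case: eqP => [xy|]; rewrite ?mulr0 // xy yi in xi *.
rewrite (bigD1 j) //= ent xE mul1r big1 ?addr0 // => i ij.
rewrite ent; case: (boolP (x \in E i)) => [/Euniq|]; last by rewrite mul0r.
by move=> ji; rewrite ji eqxx in ij.
Qed.

(** The bridge from the eigenvector equation to the maximum principle; the constants agree because
    there are Q digits. *)
Lemma coincidence_harmonicP S v :
  (coincidence_mx R S)^T *m v = (volume q)%:R *: v <->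
  forall x, step_harmonic (bisubst S) (fun y => entry v y.1 y.2) x.
Proof.
split=> [Cv x|vH].
  by rewrite /step_harmonic card_digit -entryZ -Cv entry_coincidence_tr.
apply: entry_inj => x; rewrite entry_coincidence_tr entryZ -card_digit.
exact/esym/vH.
Qed.

End PairCoordinates.

(** * Ergodic classes as closed irreducible sets *)

Section ErgodicClasses.
Variables (d : nat) (q : base d) (B : finType) (S : substitution q B).
Variables (J : nat) (E : 'I_J -> {set B}) (T : {set B}).
Hypothesis ET : ergodic_decomposition S 1 E T.

Lemma class_closed i g k : g \in E i -> S g k \in E i.
Proof.
case: ET => _ _ /(_ i)[clo _] _ gE; apply: (clo g _ gE).
by apply/occurs_subst; exists k.
Qed.

(** Every letter of the class occurs in an iterate on [g]. This supplies the irreducibility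
    hypothesis of [harmonic_const]. *)
Lemma class_irreducible i (P : {set B}) :
  (forall g k, g \in P -> S g k \in P) ->
  forall g a, g \in E i -> g \in P -> a \in E i -> a \in P.
Proof.
move=> PS g a gE gP aE; case: ET => _ _ /(_ i)[_ [n _ occ]] _.
exact: (occurs_iter_closed PS gP (occ a g aE gE)).
Qed.

Lemma transient_exit g : g \in T -> exists k, S g k \notin T.
Proof.
case: ET => _ _ _ /(_ g) exT /exT[a aT /occurs_subst[k ak]].
by exists k; rewrite -ak.
Qed.

Lemma classP x : x \notin T -> exists j, x \in E j.
Proof.
case: ET => _ /and3P[/eqP cov _ _] _ _; rewrite -finset.in_setC -cov.
by case/bigcupP => _ /imsetP[j _ ->]; exists j.
Qed.

Lemma class_recurrent x j : x \in E j -> x \notin T.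
Proof.
case: ET => _ /and3P[/eqP cov _ _] _ _ xE; rewrite -finset.in_setC -cov.
by apply/bigcupP; exists (E j) => //; exact: imset_f.
Qed.

Lemma class_uniq x i j : x \in E i -> x \in E j -> i = j.
Proof.
case: ET => Einj /and3P[_ /finset.trivIsetP tri _] _ _ xi xj.
apply: Einj; apply/eqP; apply: contraT => neq.
have := tri _ _ (imset_f E (isT : i \in predT)) (imset_f E (isT : j \in predT)) neq.
by move=> /disjoint_setI0/setP/(_ x); rewrite !inE xi xj.
Qed.

Lemma recurrent_closed g k : g \notin T -> S g k \notin T.
Proof. by move=> /classP[j gj]; apply/class_recurrent/class_closed/gj. Qed.

End ErgodicClasses.

(** The index hidden in [ergodic_classes] is positive and minimal, and 1 is admissible. *)
Lemma ergodic_classes1 d (q : base d) (B : finType) (S : substitution q B)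
    J (E : 'I_J -> {set B}) T :
  imprimitivity_index S 1 -> ergodic_classes S E T ->
  ergodic_decomposition S 1 E T.
Proof.
move=> [_ dec1 _] [h [h0 _ hmin]] dec; suff <- : h = 1%N by [].
by apply/eqP; rewrite eqn_leq h0 andbT; exact: hmin.
Qed.

(** * Solution of the Dirichlet problem on the transient part *)

Section HarmonicRepresentation.
Variables (R : realType) (d : nat) (q : base d) (A : finType).
Variable S : substitution q A.
Variables (J : nat) (E : 'I_J -> {set A * A}) (T : {set A * A}).
Hypothesis ET : ergodic_decomposition (bisubst S) 1 E T.
Local Notation C := R[i].
Local Notation vec := 'cV[C]_(#|A| * #|A|).
Implicit Types (v : vec) (w : 'I_J -> C).
Let Q : C := (volume q)%:R.
Let CSt := (coincidence_mx R S)^T.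
Let CTt := coincidence_tr_transient R S T.

Lemma entry_class x j w : x \in E j -> entry (class_vec E w) x.1 x.2 = w j.
Proof.
by move=> xj; apply: entry_class_vec => // i xi; exact: (class_uniq ET xi xj).
Qed.

Lemma proj_transient_id v :
  (forall x, x \notin T -> entry v x.1 x.2 = 0) -> proj_transient R T *m v = v.
Proof.
move=> v0; apply: entry_inj => x; rewrite entry_proj_transient.
by case: (boolP (x \in T)) => [|/v0->]; rewrite ?mul1r ?mul0r.
Qed.

(** The images of a recurrent pair are recurrent, and there the projection erases [v]. *)
Lemma coincidence_transient_entry0 v x :
  x \notin T -> entry (CTt *m v) x.1 x.2 = 0.
Proof.
move=> xT; rewrite /CTt /coincidence_tr_transient -mulmxA.
rewrite entry_coincidence_tr big1 // => j _.
by rewrite entry_proj_transient (negPf (recurrent_closed ET _ xT)) mul0r.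
Qed.

Lemma Q_neq0 : Q != 0.
Proof. by rewrite pnatr_eq0 -lt0n volume_gt0. Qed.

Lemma transient_support v :
  (forall x, x \notin T -> entry ((Q%:M - CTt) *m v) x.1 x.2 = 0) ->
  forall x, x \notin T -> entry v x.1 x.2 = 0.
Proof.
move=> v0 x xT; have := v0 x xT.
rewrite mulmxBl mul_scalar_mx entryB entryZ coincidence_transient_entry0 //.
by rewrite subr0 => /eqP; rewrite mulf_eq0 (negPf Q_neq0) => /eqP.
Qed.


(** The projection fixes vectors supported in [T]; this is what lets harmonicity be read off an
    equation in [CTt]. *)
Lemma transient_sub_mul v :
  (forall x, x \notin T -> entry v x.1 x.2 = 0) -> CTt *m v = CSt *m v.
Proof. by move=> v0; rewrite /CTt -mulmxA proj_transient_id. Qed.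

(* Off T the matrix acts as multiplication by Q, so a vector of its kernel
   vanishes there and is therefore harmonic. *)
Lemma transient_resolvent_unit : Q%:M - CTt \in unitmx.
Proof.
rewrite -unitmx_tr -row_free_unit; apply: inj_row_free => r rK.
suff : r^T = 0 by move=> /(congr1 trmx); rewrite trmxK trmx0.
have {rK} : (Q%:M - CTt) *m r^T = 0.
  by apply: trmx_inj; rewrite trmx_mul trmxK rK trmx0.
move: (r^T) => v vK.
have v0 : forall x, x \notin T -> entry v x.1 x.2 = 0.
  by apply: transient_support => x _; rewrite vK /entry mxE.
have vH : CSt *m v = Q *: v.
  move: vK; rewrite mulmxBl mul_scalar_mx transient_sub_mul // => /eqP.
  by rewrite subr_eq0 => /eqP.
have {}vH := (coincidence_harmonicP _ _).1 vH.
apply: entry_inj => x; rewrite [RHS]mxE.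
exact: (complex_harmonic_eq0 (f := fun y => entry v y.1 y.2) vH v0
  (transient_exit ET)).
Qed.

(** Clears the inverse, leaving a linear equation for the correction [v - class_vec E w]. *)
Lemma representedP v w :
  v = class_vec E w - invmx (Q%:M - CTt) *m ((Q%:M - CSt) *m class_vec E w) <->
  (Q%:M - CTt) *m (v - class_vec E w) = - ((Q%:M - CSt) *m class_vec E w).
Proof.
have U := transient_resolvent_unit; split=> [->|e].
  by rewrite addrAC subrr add0r mulmxN mulKVmx.
by rewrite -mulmxN -e mulKmx // addrC subrK.
Qed.

Lemma represented_harmonic v w :
  v = class_vec E w - invmx (Q%:M - CTt) *m ((Q%:M - CSt) *m class_vec E w) ->
  CSt *m v = Q *: v /\ forall j x, x \in E j -> entry v x.1 x.2 = w j.
Proof.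
move=> /representedP; set V := class_vec E w => e.
(* All images of a pair in [E j] carry the value [w j], so the right side of [e] vanishes on the
   classes and the correction is supported in [T]. *)
have u0 : forall x, x \notin T -> entry (v - V) x.1 x.2 = 0.
  apply: transient_support => x /(classP ET)[j xj].
  rewrite e mulmxBl mul_scalar_mx opprB entryB entryZ entry_coincidence_tr.
  rewrite (eq_bigr (fun=> w j)) => [|k _]; last first.
    by rewrite (entry_class _ (class_closed ET k xj)).
  by rewrite sumr_const card_digit (entry_class _ xj) mulr_natl subrr.
split=> [|j x xj]; last first.
  have /eqP := u0 x (class_recurrent ET xj).
  by rewrite entryB (entry_class _ xj) subr_eq0 => /eqP.
(* With [CSt] in place of [CTt], the two sides of [e] combine into [(Q%:M - CSt) *m v = 0]. *)
move: e => /eqP; rewrite -subr_eq0 opprK mulmxBl transient_sub_mul //.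
rewrite -mulmxBl -mulmxDr subrK mulmxBl mul_scalar_mx subr_eq0.
by move=> /eqP.
Qed.

Lemma harmonic_represented v :
  CSt *m v = Q *: v -> exists w,
  v = class_vec E w - invmx (Q%:M - CTt) *m ((Q%:M - CSt) *m class_vec E w).
Proof.
move=> vH; have fH := (coincidence_harmonicP _ _).1 vH.
(* The value of [v] at any pair of the class; the default 0 would serve only an empty class. *)
pose w j := if [pick x in E j] is Some x then entry v x.1 x.2 else 0.
exists w; apply/representedP.
have vw j x : x \in E j -> entry v x.1 x.2 = w j.
  move=> xj; rewrite /w; case: pickP => [y yj|/(_ x)]; last by rewrite xj.
  apply: (@complex_harmonic_const _ _ _ (bisubst S)
    (fun y => entry v y.1 y.2) (E j) _ _ _ x y xj yj) => [//|z k|].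
  - exact: (class_closed ET).
  - exact: (class_irreducible ET).
rewrite mulmxBl transient_sub_mul => [|x /(classP ET)[j xj]]; last first.
  by rewrite entryB (entry_class _ xj) (vw _ _ xj) subrr.
by rewrite -mulmxBl mulmxBr mulmxBl mul_scalar_mx vH subrr add0r.
Qed.

End HarmonicRepresentation.

(** * Letter frequencies and the normalisation of the hull *)

Section LetterFrequencies.
Variables (R : realType) (d : nat) (q : base d) (A : finType).
Variables (hA : (2 <= #|A|)%N) (S : substitution q A).
Variable mu : probability (borel_config hA d) R.

Lemma cylinder_measurable a :
  measurable (cylinder S a : set (borel_config hA d)).
Proof.
apply: measurableI; first exact: measurable_subst_space.
apply: sub_sigma_algebra; rewrite /= openE => x /= <-.
apply: (@proj_continuous (Zd d) (fun=> discrete_topology A) 0 x [set x 0]).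
exact: discrete_set1.
Qed.

(** The letter at the origin splits [subst_space S] into disjoint measurable cylinders. *)
Lemma sum_letter_freq : mu (subst_space S) = 1%E ->
  \sum_(a : A) letter_freq mu S a = 1.
Proof.
move=> mu1; rewrite /letter_freq -rmorph_sum /= sum_fine; last first.
  by move=> a _; apply: fin_num_measure; exact: cylinder_measurable.
suff -> : (\sum_(a : A) mu (cylinder S a) = 1)%E by [].
rewrite -mu1 fsbig_seq ?index_enum_uniq //= -measure_fin_bigcup //.
- congr (mu _); apply/seteqP; split=> [x [a _ []]//|x xS].
  by exists (x 0) => //=; exact: mem_index_enum.
- by move=> a b _ _ [x [[_ <-] [_ <-]]].
- by move=> a _; exact: cylinder_measurable.
Qed.

Lemma mul_Sigma0 (v : 'cV[R[i]]_(#|A| * #|A|)) :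
  (v^T *m Sigma0 mu S) 0 0 = \sum_(a : A) entry v a a * letter_freq mu S a.
Proof.
rewrite mulmx_sumr summxE; apply: eq_bigr => a _.
by rewrite -scalemxAr /basis_vec -colE !mxE mulrC.
Qed.

End LetterFrequencies.

(** * Characterisation of the spectral hull and its two special cases *)

Theorem proposition3p13 (R : realType) (d : nat) (hd : (1 <= d)%N)
    (q : base d) (A : finType) (hA : (2 <= #|A|)%N) (S : substitution q A)
    (hS : imprimitivity_index S 1)
    (hSS : imprimitivity_index (bisubst S) 1)
    (J : nat) (E : 'I_J -> {set A * A}) (T : {set A * A})
    (hET : ergodic_classes (bisubst S) E T)
    (mu : probability (borel_config hA d) R)
    (hmu : invariant_measure S mu) :
  let Q : R[i] := (volume q)%:R in
  let CSt := (coincidence_mx R S)^T in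
  let CTt := coincidence_tr_transient R S T in
  let represented (v : 'cV[R[i]]_(#|A| * #|A|)) (w : 'I_J -> R[i]) : Prop :=
    v = class_vec E w
        - invmx (Q%:M - CTt) *m ((Q%:M - CSt) *m class_vec E w) in
  [/\ Q%:M - CTt \in unitmx,
      forall v : 'cV[R[i]]_(#|A| * #|A|),
        spectral_hull mu S v <->
        [/\ assoc_mx v \is hermsymmx,
            forall c : R[i], eigenvalue (assoc_mx v) c -> 0 <= c,
            \sum_(a : A) entry v a a * letter_freq mu S a = 1 &
            exists w : 'I_J -> R[i], represented v w],
      forall v : 'cV[R[i]]_(#|A| * #|A|), spectral_hull mu S v ->
        T = finset.set0 ->
        forall w : 'I_J -> R[i], represented v w -> v = class_vec E w &
      forall v : 'cV[R[i]]_(#|A| * #|A|), spectral_hull mu S v ->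
        primitive S -> forall a : A, entry v a a = 1].
Proof.
move=> Q CSt CTt represented.
have ET := ergodic_classes1 hSS hET.
have muS : mu (subst_space S) = 1%E by case: hmu.
have hull_harmonic v : spectral_hull mu S v -> CSt *m v = Q *: v by case.
split.
- exact: transient_resolvent_unit ET.
- move=> v; split=> [[Cv /form_ge0P[vh ve] v1]|[vh ve v1 [w rep]]].
    by split; rewrite // -?mul_Sigma0 //; exact: (harmonic_represented ET).
  split; rewrite ?mul_Sigma0 //; last by apply/form_ge0P.
  by have [] := represented_harmonic ET rep.
- move=> v _ T0 w rep; apply: entry_inj => x.
  (* With no transient pair, [x] lies in a class, where [v] and [class_vec E w] both take the value
     [w j]. *)
  have [|j xj] := classP ET (x := x); first by rewrite T0 finset.in_set0.
  have [_ vw] := represented_harmonic ET rep.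
  by rewrite (vw _ _ xj) (entry_class ET _ xj).
- move=> v vK [n _ prim] a.
  have /coincidence_harmonicP vH := hull_harmonic v vK.
  (* The instructions send diagonal pairs to diagonal pairs, so the diagonal of [v] is harmonic for
     [S] itself. *)
  have diagH b : step_harmonic S (fun c => entry v c c) b by exact: (vH (b, b)).
  (* Primitivity makes the whole alphabet irreducible, so the maximum principle applies to the full
     set of letters. *)
  have const b : entry v b b = entry v a a.
    apply: (@complex_harmonic_const _ _ _ S (fun c => entry v c c)
      [set: A]%SET) => [c _|c k _|P PS c e _ cP _||]; rewrite ?finset.inE //.
    exact: (occurs_iter_closed PS cP (prim e c)).
  (* The normalisation is now the constant diagonal value times the sum of the frequencies, which is
     1. *)
  case: vK => _ _; rewrite mul_Sigma0.
  under eq_bigr do rewrite const.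
  by rewrite -mulr_sumr sum_letter_freq // mulr1.
Qed.
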